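(* Let $\Bbbk$ be a field of characteristic zero and let $\mathcal{A}$ be a central arrangement of three lines in $\Bbbk^2$, with coordinates chosen so that its defining polynomial is $Q=xF$ with $F=y(tx+y)$, $t\in\Bbbk\setminus\{0\}$. The Lie algebra of outer derivations of $\mathsf{Diff}\,\mathcal{A}$, with the bracket induced by the commutator of derivations, is an abelian Lie algebra of dimension three generated by the classes of the derivations $\partial_1$, $\partial_2$ and $\partial_3$ defined in the context.
   Context: Let $S=\Bbbk[x,y]$. The algebra $U=\mathsf{Diff}\,\mathcal{A}$ of differential operators on $S$ that preserve the ideal $QS$ and all its powers is generated by symbols $x,y,D,E$ (where $E=x\partial_x+y\partial_y$ and $D=F\partial_y$) subject to the relations $[y,x]=0$, $[D,x]=0$, $[D,y]=F$, $[E,x]=x$, $[E,y]=y$, $[E,D]=D$. The Lie algebra of outer derivations of $U$ is the quotient of the Lie algebra of $\Bbbk$-linear derivations of $U$ by the inner derivations; it is isomorphic to $HH^1(U)$. If $f\in\Bbbk x\oplus\Bbbk y$ is a nonzero linear form dividing $xF$, there is a derivation $\partial_f:U\to U$ such that $\partial_f(x)=\partial_f(y)=0$, $\partial_f(D)=\frac{F}{f}\,\frac{\partial f}{\partial y}$ and $\partial_f(E)=1$ (when $f$ is a multiple of $x$, $\partial_f(D)=0$). Let $f_1=x$, $f_2=y$, $f_3=tx+y$ and $\partial_i=\partial_{f_i}$ for $1\le i\le3$. *)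

(* Defs.v *)
From HB Require Import structures.
From mathcomp Require Import all_boot all_algebra.
From mathcomp Require Import boolp mpoly ring.

Set Implicit Arguments.
Unset Strict Implicit.
Unset Printing Implicit Defensive.

Import GRing.Theory.
Local Open Scope ring_scope.
Local Open Scope quotient_scope.

Section LinearEndomorphisms.
Variables (K : fieldType) (V : lmodType K).

(* The ring structure put on [lend] is that of composition. *)
Definition lend := {linear V -> V}.

Identity Coercion linear_of_lend : lend >-> GRing.Linear.type.

HB.instance Definition _ := gen_eqMixin lend.
HB.instance Definition _ := gen_choiceMixin lend.

Implicit Types f g h : lend.

Lemma lendP f g : f =1 g -> f = g.
Proof.
destruct f as [f [[fD] [fZ]]], g as [g [[gD] [gZ]]] => /= /funext fg; subst g.
by rewrite (Prop_irrelevance fD gD) (Prop_irrelevance fZ gZ).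
Qed.

Definition lend_zero : lend := \0.
Definition lend_opp f : lend := \- f.
Definition lend_add f g : lend := f \+ g.
Definition lend_scale (a : K) f : lend := a \*: f.
Definition lend_one : lend := idfun.
Definition lend_mul f g : lend := f \o g.

Fact lend_addA : associative lend_add.
Proof. by move=> f g h; apply: lendP => v /=; rewrite addrA. Qed.
Fact lend_addC : commutative lend_add.
Proof. by move=> f g; apply: lendP => v /=; rewrite addrC. Qed.
Fact lend_add0 : left_id lend_zero lend_add.
Proof. by move=> f; apply: lendP => v /=; rewrite add0r. Qed.
Fact lend_addN : left_inverse lend_zero lend_opp lend_add.
Proof. by move=> f; apply: lendP => v /=; rewrite addNr. Qed.

HB.instance Definition _ :=
  GRing.isZmodule.Build lend lend_addA lend_addC lend_add0 lend_addN.

Fact lend_scaleA a b f : lend_scale a (lend_scale b f) = lend_scale (a * b) f.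
Proof. by apply: lendP => v /=; rewrite scalerA. Qed.
Fact lend_scale1 : left_id 1 lend_scale.
Proof. by move=> f; apply: lendP => v /=; rewrite scale1r. Qed.
Fact lend_scaleDr : right_distributive lend_scale +%R.
Proof. by move=> a f g; apply: lendP => v /=; rewrite scalerDr. Qed.
Fact lend_scaleDl f : {morph lend_scale^~ f : a b / a + b}.
Proof. by move=> a b; apply: lendP => v /=; rewrite scalerDl. Qed.

HB.instance Definition _ := GRing.Zmodule_isLmodule.Build K lend
  lend_scaleA lend_scale1 lend_scaleDr lend_scaleDl.

Fact lend_mulA : associative lend_mul.
Proof. by move=> f g h; apply: lendP. Qed.
Fact lend_mul1 : left_id lend_one lend_mul.
Proof. by move=> f; apply: lendP. Qed.
Fact lend_mulr1 : right_id lend_one lend_mul.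
Proof. by move=> f; apply: lendP. Qed.
Fact lend_mulDl : left_distributive lend_mul +%R.
Proof. by move=> f g h; apply: lendP. Qed.
Fact lend_mulDr : right_distributive lend_mul +%R.
Proof. by move=> f g h; apply: lendP => v /=; rewrite linearD. Qed.

HB.instance Definition _ := GRing.Zmodule_isPzRing.Build lend
  lend_mulA lend_mul1 lend_mulr1 lend_mulDl lend_mulDr.

Lemma lendD f g v : (f + g) v = f v + g v. Proof. by []. Qed.
Lemma lendN f v : (- f) v = - f v. Proof. by []. Qed.
Lemma lendZ a f v : (a *: f) v = a *: f v. Proof. by []. Qed.
Lemma lendM f g v : (f * g) v = f (g v). Proof. by []. Qed.
Lemma lend0 v : (0 : lend) v = 0. Proof. by []. Qed.
Lemma lend1 v : (1 : lend) v = v. Proof. by []. Qed.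

End LinearEndomorphisms.

HB.mixin Record Lmodule_isLieAlgebra (K : fieldType) V of GRing.Lmodule K V := {
  lie : V -> V -> V;
  lieDl : forall u v w : V, lie (u + v) w = lie u w + lie v w;
  lieZl : forall (a : K) (u v : V), lie (a *: u) v = a *: lie u v;
  lieDr : forall u v w : V, lie u (v + w) = lie u v + lie u w;
  lieZr : forall (a : K) (u v : V), lie u (a *: v) = a *: lie u v;
  liexx : forall u : V, lie u u = 0;
  lie_jacobi : forall u v w : V,
    lie u (lie v w) + lie v (lie w u) + lie w (lie u v) = 0
}.

#[short(type="lieAlgType")]
HB.structure Definition LieAlgebra (K : fieldType) :=
  {V of GRing.Lmodule K V & Lmodule_isLieAlgebra K V}.

Section LieTheory.
Variables (K : fieldType) (L : lieAlgType K).

Lemma lieC (u v : L) : lie u v = - lie v u.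
Proof.
apply/eqP; rewrite -addr_eq0; apply/eqP.
by have := liexx (u + v); rewrite lieDl !lieDr !liexx add0r addr0.
Qed.

Definition lie_abelian : Prop := forall u v : L, lie u v = 0.

(* The smallest Lie subalgebra containing [gen] is the whole of [L]. *)
Definition lie_generated (gen : L -> Prop) : Prop :=
  forall P : L -> Prop,
    P 0 -> (forall (a : K) u v, P u -> P v -> P (a *: u + v)) ->
    (forall u v, P u -> P v -> P (lie u v)) ->
    (forall u, gen u -> P u) -> forall u, P u.

End LieTheory.

Definition has_dimension (K : fieldType) (V : lmodType K) (n : nat) : Prop :=
  exists b : 'I_n -> V,
    forall v : V, exists! c : 'rV[K]_n, v = \sum_(i < n) c 0 i *: b i.

Section Derivations.
Variables (K : fieldType) (A : algType K).

Definition leibniz (d : lend A) : Prop :=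
  forall a b : A, d (a * b) = d a * b + a * d b.

Definition derivation_pred : {pred lend A} := fun d => `[< leibniz d >].

Fact derivation_submod : submod_closed derivation_pred.
Proof.
split=> [|c d e /asboolP dP /asboolP eP]; apply/asboolP => a b.
  by rewrite !lend0 mul0r mulr0 addr0.
rewrite !lendD !lendZ dP eP scalerDr scalerAl scalerAr mulrDl mulrDr.
by rewrite addrACA.
Qed.

HB.instance Definition _ :=
  GRing.isSubmodClosed.Build K (lend A) derivation_pred derivation_submod.

Record derivation := Derivation {
  der_val :> lend A;
  der_valP : der_val \in derivation_pred }.

HB.instance Definition _ := [isSub for der_val].
HB.instance Definition _ := [Choice of derivation by <:].
HB.instance Definition _ := [SubChoice_isSubLmodule of derivation by <:].

Lemma derivation_leibniz (d : derivation) : leibniz d.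
Proof. by have /asboolP := der_valP d. Qed.

Fact der_lie_subproof (d e : derivation) :
  der_val d * der_val e - der_val e * der_val d \in derivation_pred.
Proof.
apply/asboolP => a b; rewrite !lendD !lendN !lendM.
have dM := derivation_leibniz d; have eM := derivation_leibniz e.
rewrite dM eM 2!linearD /= !dM !eM mulrBl mulrBr.
set p := _ * _; set q := d a * e b; set r := e a * d b; set s := a * _.
set p' := _ * b; set s' := a * _.
rewrite !opprD !addrA [LHS](ACl (((1*5)*(4*8))*((3*6)*(2*7))))/=.
by rewrite !subrr !addr0 addrA.
Qed.

Definition der_lie (d e : derivation) : derivation :=
  Derivation (der_lie_subproof d e).

Fact der_lieDl u v w : der_lie (u + v) w = der_lie u w + der_lie v w.
Proof.
by apply: val_inj; rewrite /= mulrDl mulrDr opprD addrACA.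
Qed.

Fact der_lieZl a u v : der_lie (a *: u) v = a *: der_lie u v.
Proof.
apply: val_inj; apply: lendP => x /=.
by rewrite linearZ /= scalerBr.
Qed.

Fact der_lieDr u v w : der_lie u (v + w) = der_lie u v + der_lie u w.
Proof.
by apply: val_inj; rewrite /= mulrDl mulrDr opprD addrACA.
Qed.

Fact der_lieZr a u v : der_lie u (a *: v) = a *: der_lie u v.
Proof.
apply: val_inj; apply: lendP => x /=.
by rewrite linearZ /= scalerBr.
Qed.

Fact der_liexx u : der_lie u u = 0.
Proof. by apply: val_inj; rewrite /= subrr. Qed.

Fact der_lie_jacobi u v w :
  der_lie u (der_lie v w) + der_lie v (der_lie w u) + der_lie w (der_lie u v)
  = 0.
Proof.
apply: val_inj => /=; rewrite !mulrBl !mulrBr !mulrA !opprB !addrA.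
rewrite [LHS](ACl ((1*12)*(5*4)*(7*2)*(3*10)*(9*8)*(11*6)))/=.
by rewrite !subrr !addr0.
Qed.

HB.instance Definition _ := Lmodule_isLieAlgebra.Build K derivation
  der_lieDl der_lieZl der_lieDr der_lieZr der_liexx der_lie_jacobi.

Section Inner.
Variable a : A.

Definition ad_fun (b : A) : A := a * b - b * a.

Fact ad_fun_linear : linear ad_fun.
Proof.
move=> c u v; rewrite /ad_fun mulrDl mulrDr scalerBr scalerAr scalerAl opprD.
by rewrite addrACA.
Qed.

HB.instance Definition _ := GRing.isLinear.Build K A A *:%R ad_fun ad_fun_linear.

Fact ad_subproof : (ad_fun : lend A) \in derivation_pred.
Proof.
apply/asboolP => u v /=; rewrite /ad_fun mulrBl mulrBr !mulrA addrA.
by rewrite subrK.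
Qed.

Definition ad : derivation := Derivation ad_subproof.

End Inner.

Definition inner_pred : {pred derivation} := fun d => `[< exists a, d = ad a >].

Lemma ad_inner (a : A) : ad a \in inner_pred.
Proof. by apply/asboolP; exists a. Qed.

Fact inner_submod : submod_closed inner_pred.
Proof.
split=> [|c d e /asboolP[a ->] /asboolP[b ->]]; apply/asboolP.
  exists 0; apply: val_inj; apply: lendP => u /=.
  by rewrite /ad_fun mul0r mulr0 subr0.
exists (c *: a + b); apply: val_inj; apply: lendP => u /=.
rewrite /ad_fun mulrDl mulrDr opprD addrACA scalerBr.
by rewrite -!scalerAr -!scalerAl.
Qed.

HB.instance Definition _ :=
  GRing.isSubmodClosed.Build K derivation inner_pred inner_submod.

Lemma lie_ad (d : derivation) (a : A) : lie d (ad a) = ad (d a).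
Proof.
apply: val_inj; apply: lendP => u /=.
rewrite /ad_fun linearB /= !derivation_leibniz.
rewrite opprB opprD !addrA [LHS](ACl ((1*4)*(2*6)*(5*3)))/=.
by rewrite !subrr !addr0.
Qed.

Definition outer_derivation := Quotient.quot inner_pred.

HB.instance Definition _ := GRing.Zmodule.on outer_derivation.

(* The Lie algebra structure of [outer_derivation] is given below; its bracket
   is characterized by [out_lieE]. *)
Definition out_class (d : derivation) : outer_derivation :=
  \pi_outer_derivation d.

Lemma out_class_eq (d e : derivation) :
  (out_class d == out_class e) = (d - e \in inner_pred).
Proof. by rewrite Quotient.idealrBE. Qed.

Lemma out_classP (d e : derivation) :
  out_class d = out_class e <-> exists a, d - e = ad a.
Proof.
split=> [/eqP|de]; last apply/eqP; rewrite out_class_eq.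
  by move=> /asboolP.
exact/asboolP.
Qed.

Lemma out_class_repr (u : outer_derivation) : out_class (repr u) = u.
Proof. exact: reprK. Qed.

Lemma repr_out_class (d : derivation) : repr (out_class d) - d \in inner_pred.
Proof. by rewrite -out_class_eq out_class_repr. Qed.

Lemma out_classD (d e : derivation) :
  out_class (d + e) = out_class d + out_class e.
Proof. by rewrite /out_class !piE. Qed.

Definition out_scale (a : K) (u : outer_derivation) := out_class (a *: repr u).

Lemma out_scaleE a d : out_scale a (out_class d) = out_class (a *: d).
Proof.
by apply/eqP; rewrite out_class_eq -scalerBr rpredZ ?repr_out_class.
Qed.

Fact out_scaleA a b u : out_scale a (out_scale b u) = out_scale (a * b) u.
Proof. by rewrite -(out_class_repr u) !out_scaleE scalerA. Qed.
Fact out_scale1 : left_id 1 out_scale.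
Proof. by move=> u; rewrite -(out_class_repr u) out_scaleE scale1r. Qed.
Fact out_scaleDr : right_distributive out_scale +%R.
Proof.
move=> a u v; rewrite -(out_class_repr u) -(out_class_repr v).
by rewrite -out_classD !out_scaleE scalerDr out_classD.
Qed.
Fact out_scaleDl u : {morph out_scale^~ u : a b / a + b}.
Proof.
move=> a b /=; rewrite -(out_class_repr u).
by rewrite !out_scaleE scalerDl out_classD.
Qed.

HB.instance Definition _ := GRing.Zmodule_isLmodule.Build K outer_derivation
  out_scaleA out_scale1 out_scaleDr out_scaleDl.

Fact out_class_linear : linear out_class.
Proof. by move=> a d e; rewrite out_classD -out_scaleE. Qed.

HB.instance Definition _ :=
  GRing.isLinear.Build K derivation outer_derivation *:%R out_class
    out_class_linear.

Definition out_lie (u v : outer_derivation) := out_class (lie (repr u) (repr v)).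

Lemma out_lieE d e : out_lie (out_class d) (out_class e) = out_class (lie d e).
Proof.
have /asboolP[a da] := repr_out_class d; have /asboolP[b eb] := repr_out_class e.
move: da eb => /eqP; rewrite subr_eq => /eqP da /eqP; rewrite subr_eq => /eqP eb.
apply/eqP; rewrite /out_lie out_class_eq da eb lieDl !lieDr addrA addrK.
by rewrite !lie_ad [lie _ e]lieC lie_ad !(rpredD, rpredN) ?ad_inner.
Qed.

Fact out_lieDl u v w : out_lie (u + v) w = out_lie u w + out_lie v w.
Proof.
rewrite -(out_class_repr u) -(out_class_repr v) -(out_class_repr w).
by rewrite -out_classD !out_lieE lieDl out_classD.
Qed.

Fact out_lieZl a u v : out_lie (a *: u) v = a *: out_lie u v.
Proof.
rewrite -(out_class_repr u) -(out_class_repr v) -linearZ /=.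
by rewrite !out_lieE lieZl linearZ.
Qed.

Fact out_lieDr u v w : out_lie u (v + w) = out_lie u v + out_lie u w.
Proof.
rewrite -(out_class_repr u) -(out_class_repr v) -(out_class_repr w).
by rewrite -out_classD !out_lieE lieDr out_classD.
Qed.

Fact out_lieZr a u v : out_lie u (a *: v) = a *: out_lie u v.
Proof.
rewrite -(out_class_repr u) -(out_class_repr v) -linearZ /=.
by rewrite !out_lieE lieZr linearZ.
Qed.

Fact out_liexx u : out_lie u u = 0.
Proof. by rewrite -(out_class_repr u) out_lieE liexx linear0. Qed.

Fact out_lie_jacobi u v w :
  out_lie u (out_lie v w) + out_lie v (out_lie w u) + out_lie w (out_lie u v)
  = 0.
Proof.
rewrite -(out_class_repr u) -(out_class_repr v) -(out_class_repr w).
by rewrite !out_lieE -!linearD /= lie_jacobi linear0.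
Qed.

HB.instance Definition _ := Lmodule_isLieAlgebra.Build K outer_derivation
  out_lieDl out_lieZl out_lieDr out_lieZr out_liexx out_lie_jacobi.

End Derivations.

Section DifferentialOperators.
Variable K : fieldType.

Local Notation S := {mpoly K[2]}.

Definition endS := lend S.

Identity Coercion lend_of_endS : endS >-> lend.

HB.instance Definition _ := GRing.PzRing.on endS.
HB.instance Definition _ := GRing.Lmodule.on endS.

Fact endS_neq0 : (1 : endS) != 0.
Proof.
apply/eqP => /(congr1 (fun f : endS => f 1)) /=.
by move/eqP; rewrite oner_eq0.
Qed.

HB.instance Definition _ := GRing.PzSemiRing_isNonZero.Build endS endS_neq0.

Fact endS_scaleAl (a : K) (f g : endS) : a *: (f * g) = a *: f * g.
Proof. by apply: lendP. Qed.
Fact endS_scaleAr (a : K) (f g : endS) : a *: (f * g) = f * (a *: g).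
Proof. by apply: lendP => p /=; rewrite linearZ. Qed.

HB.instance Definition _ := GRing.Lmodule_isLalgebra.Build K endS endS_scaleAl.
HB.instance Definition _ := GRing.Lalgebra_isAlgebra.Build K endS endS_scaleAr.

Fact mul_linear (p : S) : linear ( *%R p : S -> S).
Proof. by move=> a u v; rewrite mulrDr scalerAr. Qed.

Definition mulS (p : S) : endS :=
  HB.pack_for {linear S -> S} ( *%R p : S -> S)
    (GRing.isLinear.Build K S S *:%R ( *%R p : S -> S) (mul_linear p)).

Definition partialS (i : 'I_2) : endS := [the {linear S -> S} of mderiv i].

Lemma mulSE p q : mulS p q = p * q. Proof. by []. Qed.
Lemma partialSE i q : partialS i q = q^`M(i). Proof. by []. Qed.

(* Grothendieck's differential operators, indexed by a strict bound on the
   order: [diff_order_lt n.+1 P] says that [P] has order at most [n]. *)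
Fixpoint diff_order_lt (n : nat) (P : endS) : Prop :=
  if n is m.+1 then forall p : S, diff_order_lt m (P * mulS p - mulS p * P)
  else P = 0.

Definition differential_operator (P : endS) : Prop :=
  exists n, diff_order_lt n P.

Definition preserves_powers (Q : S) (P : endS) : Prop :=
  forall n p, exists q, P (Q ^+ n * p) = Q ^+ n * q.

Lemma diff_order_lt0 n : diff_order_lt n 0.
Proof. by elim: n => //= n IH p; rewrite mul0r mulr0 subr0. Qed.

Lemma diff_order_ltP n a P R :
  diff_order_lt n P -> diff_order_lt n R -> diff_order_lt n (a *: P + R).
Proof.
elim: n P R => [|n IH] P R /= => [-> ->|HP HR p]; first by rewrite scaler0 addr0.
rewrite mulrDl mulrDr opprD addrACA -scalerAl -scalerAr -scalerBr.
exact: IH.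
Qed.

Lemma diff_order_ltS n P : diff_order_lt n P -> diff_order_lt n.+1 P.
Proof.
elim: n P => [|n IH] P; first by move=> /= -> p; rewrite mul0r mulr0 subr0.
by move=> HP p; apply: IH; apply: HP.
Qed.

Lemma diff_order_lt_le m n P :
  (m <= n)%N -> diff_order_lt m P -> diff_order_lt n P.
Proof.
move=> /subnK <-; elim: (n - m)%N => // k IH /IH.
exact: diff_order_ltS.
Qed.

Lemma diff_order_ltM m n P R :
  diff_order_lt m P -> diff_order_lt n R -> diff_order_lt (m + n) (P * R).
Proof.
have [k] := ubnP (m + n); elim: k m n P R => // k IH [|m] [|n] P R lemn HP HR.
- by rewrite HP mul0r.
- by rewrite HP mul0r; apply: diff_order_lt0.
- by rewrite HR mulr0; apply: diff_order_lt0.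
rewrite addSn => p.
have -> : P * R * mulS p - mulS p * (P * R) =
  1 *: (P * (R * mulS p - mulS p * R)) + (P * mulS p - mulS p * P) * R.
  by rewrite scale1r mulrBr mulrBl !mulrA addrA subrK.
apply: diff_order_ltP; last by apply: IH.
have -> : (m + n.+1)%coq_nat = (m.+1 + n)%N by rewrite addSnnS.
by apply: IH => //; rewrite addSnnS.
Qed.

Lemma diff_order_mulS p : diff_order_lt 1 (mulS p).
Proof.
by move=> q; apply: lendP => r /=; rewrite !mulrA [q * p]mulrC subrr.
Qed.

Lemma diff_order_partialS i : diff_order_lt 2 (partialS i).
Proof.
move=> p; have -> : partialS i * mulS p - mulS p * partialS i = mulS (p^`M(i)).
  by apply: lendP => r /=; rewrite mderivM addrK.
exact: diff_order_mulS.
Qed.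

Section Subalgebra.
Variable Q : S.

(* The operators that map each power of the ideal [Q S] to itself. *)
Definition diff_pred : {pred endS} :=
  fun P => `[< differential_operator P /\ preserves_powers Q P >].

Fact diff_pred_subalg : subalg_closed diff_pred.
Proof.
split.
- apply/asboolP; split=> [|n p]; last by exists p.
  exists 1%N => p; rewrite mul1r mulr1 subrr //.
- move=> a P R /asboolP[[m Pm] PQ] /asboolP[[n Rn] RQ].
  apply/asboolP; split=> [|k p].
    exists (maxn m n); apply: diff_order_ltP.
      exact: diff_order_lt_le (leq_maxl _ _) Pm.
    exact: diff_order_lt_le (leq_maxr _ _) Rn.
  have [q Pq] := PQ k p; have [r Rr] := RQ k p.
  exists (a *: q + r).
  by rewrite lendD lendZ Pq Rr mulrDr scalerAr.
- move=> P R /asboolP[[m Pm] PQ] /asboolP[[n Rn] RQ].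
  apply/asboolP; split=> [|k p]; first by exists (m + n)%N; apply: diff_order_ltM.
  have [q Rq] := RQ k p; have [r Pr] := PQ k q.
  by exists r; rewrite lendM Rq Pr.
Qed.

HB.instance Definition _ :=
  GRing.isSubalgClosed.Build K endS diff_pred diff_pred_subalg.

Record diff_arr := DiffArr {
  diff_val :> endS;
  diff_valP : diff_val \in diff_pred }.

HB.instance Definition _ := [isSub for diff_val].
HB.instance Definition _ := [Choice of diff_arr by <:].
HB.instance Definition _ := [SubChoice_isSubAlgebra of diff_arr by <:].

End Subalgebra.

Fact mulS_subproof Q p : mulS p \in diff_pred Q.
Proof.
apply/asboolP; split; first by exists 1%N; apply: diff_order_mulS.
by move=> n q; exists (p * q); rewrite mulSE mulrCA.
Qed.

Definition diff_mul Q (p : S) : diff_arr Q := DiffArr (mulS_subproof Q p).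

End DifferentialOperators.

(* Coordinates: [x = 'X_0] and [y = 'X_1]. *)
Section Arrangement.
Variables (K : fieldType) (t : K).

Local Notation S := {mpoly K[2]}.

Definition arrF : S := 'X_1 * (t *: 'X_0 + 'X_1).
Definition arrQ : S := 'X_0 * arrF.

Definition Diff := diff_arr arrQ.

Fact vector_field_subproof (a b : S) :
  (exists c, a * arrQ^`M(0) + b * arrQ^`M(1) = arrQ * c) ->
  mulS a * partialS K 0 + mulS b * partialS K 1 \in diff_pred arrQ.
Proof.
case=> c abQ; apply/asboolP; split.
  exists 3%N; rewrite -[X in X + _]scale1r.
  by apply: diff_order_ltP; apply: (@diff_order_ltM _ 1 2);
    by [apply: diff_order_mulS | apply: diff_order_partialS].
move=> n p; rewrite lendD !lendM !mulSE !partialSE.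
exists (n%:R * c * p + (a * p^`M(0) + b * p^`M(1))).
have dX i m : (arrQ ^+ m.+1)^`M(i) = m.+1%:R * arrQ ^+ m * arrQ^`M(i).
  elim: m => [|m IH]; first by rewrite expr0 expr1 mulr1 mul1r.
  by rewrite exprS mderivM IH !exprS; ring.
case: n => [|n]; first by rewrite expr0 !mul1r mulr0n !mul0r add0r.
rewrite !mderivM !dX exprS.
transitivity (n.+1%:R * arrQ ^+ n * p * (a * arrQ^`M(0) + b * arrQ^`M(1))
  + arrQ * arrQ ^+ n * (a * p^`M(0) + b * p^`M(1))); first by ring.
by rewrite abQ; ring.
Qed.

Lemma mderivX1 (i j : 'I_2) : ('X_j : S)^`M(i) = (i == j)%:R.
Proof.
rewrite mderivX mnmE; case: eqVneq => [->|ne]; last by rewrite ?scale0r.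
by rewrite -[RHS]scale1r; congr (_ *: _); rewrite -mpolyX0; congr 'X_[_];
  apply/mnmP => k; rewrite !mnmE subnn.
Qed.

Definition opx : Diff := diff_mul arrQ 'X_0.
Definition opy : Diff := diff_mul arrQ 'X_1.

Fact opE_subproof :
  mulS 'X_0 * partialS K 0 + mulS 'X_1 * partialS K 1 \in diff_pred arrQ.
Proof.
apply: vector_field_subproof; exists 3%:R.
rewrite /arrQ /arrF !(mderivM, mderivD, mderivZ, mderivX1) /=.
rewrite -!mul_mpolyC; ring.
Qed.

Definition opE : Diff := DiffArr opE_subproof.

Fact opD_subproof : mulS arrF * partialS K 1 \in diff_pred arrQ.
Proof.
rewrite -[_ * _]add0r -[X in X + _](mul0r (partialS K 0)).
have -> : (0 : endS K) = mulS 0 by apply: lendP => p /=; rewrite mul0r.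
apply: vector_field_subproof; exists (arrF^`M(1)).
rewrite /arrQ !(mderivM, mderivX1) /=; ring.
Qed.

Definition opD : Diff := DiffArr opD_subproof.

Lemma Diff_relations :
  [/\ opy * opx - opx * opy = 0,
      opD * opx - opx * opD = 0 &
      opD * opy - opy * opD = diff_mul arrQ arrF] /\
  [/\ opE * opx - opx * opE = opx,
      opE * opy - opy * opE = opy &
      opE * opD - opD * opE = opD].
Proof.
split; split; apply: val_inj; apply: lendP => p /=;
  rewrite ?(mderivM, mderivD, mderivX1) /=.
all: try by ring.
all: try by rewrite /arrF; ring.
rewrite /arrF !mderivZ !mderivX1 [(p^`M(1))^`M(0)]mderiv_comm /=.
by rewrite -!mul_mpolyC; ring.
Qed.

(* For a nonzero [f], the polynomial [g] is unique: it is the quotient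
   [(F / f) * (df/dy)], which exists when [f] divides [x F]. *)
Definition is_partial (f : S) (d : derivation Diff) : Prop :=
  [/\ d opx = 0, d opy = 0,
      (exists2 g, f * g = arrF * f^`M(1) & d opD = diff_mul arrQ g) &
      d opE = 1].

End Arrangement.

(* Main.v *)
(* The formula [d p 1], for [p] a multiplication operator, defines an operator
   [u] on [S] whose commutator with [p] is [d p].  It has finite order, and
   comparing [d E] and [d D] with [[u, E]] and [[u, D]] modulo each line shows
   that it preserves the powers of [Q S]: it is in [U].  So [d] is, up to an
   inner derivation, zero on [S], with [d E = e] and [d D = g] in [S]; the
   relation [[E, D] = D] gives [E g - g = F e_y], and subtracting [ad h] with
   [E h] equal to [e] up to its constant term leaves a constant [e] and a linear
   form [g], that is, a combination of the three [d_f].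

   A derivation zero on [S], [D] and [E] is zero: if [P] has order [n], Euler's
   identity for symbols shows that [n Q P] is, up to lower order, a combination
   of brackets of [P] with coefficients [Q dx = F E - y D] and [Q dy = x D].

   [d_f] is the bracket with [log f]: conjugation by [f] is an automorphism of
   [U] with [conj - 1] locally nilpotent, and [d_f] is its logarithm. *)

Require Import Defs.
From HB Require Import structures.
From mathcomp Require Import all_boot all_algebra.
From mathcomp Require Import boolp mpoly ring.

Set Implicit Arguments.
Unset Strict Implicit.

Import GRing.Theory.
Local Open Scope ring_scope.

(** * Divisibility and prime elements in polynomial rings *)

Section Divisibility.
Variables (n : nat) (K : fieldType).
Implicit Types f g p q r : {mpoly K[n]}.

(** Induction along the algebra structure: statements that pass through the Leibniz rule need
    checking only on the variables. *)
Lemma mpoly_alg_ind (P : {mpoly K[n]} -> Prop) :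
  (forall c, P c%:MP) -> (forall i, P 'X_i) ->
  (forall p q, P p -> P q -> P (p + q)) ->
  (forall p q, P p -> P q -> P (p * q)) -> forall p, P p.
Proof.
move=> PC PX PD PM; elim/mpolyind => [|c m p _ _ Pp]; first by rewrite -mpolyC0.
apply: PD => //; rewrite -mul_mpolyC; apply: (PM) => //; rewrite mpolyXE_id.
apply: (big_ind P) => [||i _]; [by rewrite -mpolyC1 | exact: PM |].
by elim: (m i) => [|k IH]; rewrite ?expr0 -?mpolyC1 // exprS; apply: PM.
Qed.

Definition mdvd f p := exists q, p = f * q.

Lemma mdvdD f p q : mdvd f p -> mdvd f q -> mdvd f (p + q).
Proof. by move=> [a ->] [b ->]; exists (a + b); rewrite mulrDr. Qed.

Lemma mdvdB f p q : mdvd f p -> mdvd f q -> mdvd f (p - q).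
Proof. by move=> [a ->] [b ->]; exists (a - b); rewrite mulrBr. Qed.

Lemma mdvd_mulr f p q : mdvd f p -> mdvd f (p * q).
Proof. by move=> [a ->]; exists (a * q); rewrite mulrA. Qed.

Lemma mdvd_mull f p q : mdvd f q -> mdvd f (p * q).
Proof. by rewrite mulrC; apply: mdvd_mulr. Qed.

Lemma mdvd_trans f g p : mdvd f g -> mdvd g p -> mdvd f p.
Proof. by move=> [a ->] [b ->]; exists (a * b); rewrite mulrA. Qed.

Definition mprime f := forall p q, mdvd f (p * q) -> mdvd f p \/ mdvd f q.

(** Modulo [f], the endomorphism given by [s] and the identity are algebra morphisms that agree on
    the variables. *)
Lemma mdvd_retract (s : 'I_n -> {mpoly K[n]}) f p :
  (forall i, mdvd f ('X_i - s i)) -> mdvd f (p - mmap (@mpolyC n K) s p).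
Proof.
move=> fX; elim/mpoly_alg_ind: p => [c|i|p q Hp Hq|p q Hp Hq].
- by exists 0; rewrite mmapC subrr mulr0.
- by rewrite mmapX mmap1U.
- by rewrite rmorphD opprD addrACA; apply: mdvdD.
rewrite rmorphM /= -[p * q](subrK (mmap (@mpolyC n K) s p * q)).
by rewrite -mulrBl -addrA -mulrBr; apply: mdvdD; [apply: mdvd_mulr|apply: mdvd_mull].
Qed.

(* [f] generates the kernel of the endomorphism [s] of a domain. *)
Lemma mprime_retract (s : 'I_n -> {mpoly K[n]}) f :
  (forall i, mdvd f ('X_i - s i)) -> mmap (@mpolyC n K) s f = 0 -> mprime f.
Proof.
move=> fX f0 p q [r pq].
have H v : mmap (@mpolyC n K) s v = 0 -> mdvd f v.
  by move=> v0; rewrite -[v]subr0 -v0; apply: mdvd_retract.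
have /eqP : mmap (@mpolyC n K) s (p * q) = 0 by rewrite pq rmorphM /= f0 mul0r.
by rewrite rmorphM /= mulf_eq0 => /orP[] /eqP /H; [left | right].
Qed.

End Divisibility.

(** * The Euler operator and the three lines of the arrangement *)

Section Plane.
Variables (K : fieldType) (t : K).
Local Notation S := {mpoly K[2]}.
Local Notation F := (arrF t).
Local Notation Q := (arrQ t).
Local Notation ell := (t *: 'X_0 + 'X_1 : S).

Definition euler (p : S) : S := 'X_0 * p^`M(0) + 'X_1 * p^`M(1).

Lemma ord2P (P : 'I_2 -> Prop) : P 0 -> P 1 -> forall i, P i.
Proof.
move=> P0 P1 [[|[|m]] // Hm].
  by rewrite (_ : Ordinal Hm = 0) //; apply: val_inj.
by rewrite (_ : Ordinal Hm = 1) //; apply: val_inj.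
Qed.

(** Monomials are eigenvectors of the Euler operator, with their degree as eigenvalue. *)
Lemma mcoeff_euler p m : (euler p)@_m = (mdeg m)%:R * p@_m.
Proof.
have Xd i k : 'X_i * ('X_[k] : S)^`M(i) = (k i)%:R *: 'X_[k].
  rewrite mderivX -scalerAr -mpolyXD; case: (posnP (k i)) => [->|k0].
    by rewrite !scale0r.
  by rewrite addmC submK // lep1mP -lt0n.
elim/mpolyind: p => [|c k p _ _ IH].
  by rewrite /euler !mderiv0 !mulr0 addr0 mcoeff0 mulr0.
have -> : euler (c *: 'X_[k] + p) = (c * (mdeg k)%:R) *: 'X_[k] + euler p.
  rewrite /euler !mderivD !mderivZ !mulrDr addrACA -!scalerAr !Xd -scalerDr.
  rewrite -scalerDl scalerA mdegE !big_ord_recl big_ord0 addn0 natrD.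
  by congr (_ * (_ + (k _)%:R) *: _ + _); apply: val_inj.
rewrite mcoeffD IH mcoeffD !mcoeffZ mcoeffX mulrDr.
by case: eqP => [->|_]; rewrite ?mulr1 ?mulr0 1?[c * _]mulrC.
Qed.

Lemma mprime_X0 : mprime ('X_0 : S).
Proof.
pose s (i : 'I_2) : S := if i == 0 then 0 else 'X_i.
apply: (mprime_retract (s := s)); last first.
  by rewrite mmapX mmap1U /s eqxx.
apply: ord2P; rewrite /s /=; first by exists 1; rewrite mulr1 subr0.
by exists 0; rewrite mulr0 subrr.
Qed.

Lemma mprime_line (c : K) : mprime (c *: 'X_0 + 'X_1 : S).
Proof.
(* Restriction to the line, parametrized by its first coordinate. *)
pose s (i : 'I_2) : S := if i == 0 then 'X_0 else - c *: 'X_0.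
have H : forall i, mdvd (c *: 'X_0 + 'X_1) ('X_i - s i).
  apply: ord2P; rewrite /s /=; first by exists 0; rewrite mulr0 subrr.
  by exists 1; rewrite mulr1 scaleNr opprK addrC.
apply: (mprime_retract H).
by rewrite rmorphD /= -mul_mpolyC rmorphM /= mmapC !mmapX !mmap1U /s eqxx /=
  scaleNr mul_mpolyC subrr.
Qed.

Lemma mprime_X1 : mprime ('X_1 : S).
Proof. by have := @mprime_line 0; rewrite scale0r add0r. Qed.

Lemma mprime_ell : mprime ell.
Proof. exact: mprime_line. Qed.

Lemma not_mdvd_meval (f g : S) (v : 'I_2 -> K) :
  meval v f = 0 -> meval v g != 0 -> ~ mdvd f g.
Proof. by move=> f0 /eqP g0 [q gE]; apply: g0; rewrite gE mevalM f0 mul0r. Qed.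

Definition pt (a b : K) (i : 'I_2) : K := if i == 0 then a else b.

Lemma meval_pt0 a b : meval (pt a b) 'X_0 = a.
Proof. by rewrite mevalXU. Qed.
Lemma meval_pt1 a b : meval (pt a b) 'X_1 = b.
Proof. by rewrite mevalXU. Qed.

Definition mevalE := (mevalM, mevalD, mevalZ, meval_pt0, meval_pt1).

Hypothesis t_neq0 : t != 0.

Lemma X0_neq0 : 'X_0 != 0 :> S.
Proof.
by apply/eqP => /(congr1 (meval (pt 1 0)))/eqP; rewrite !mevalE meval0 oner_eq0.
Qed.

Lemma X1_neq0 : 'X_1 != 0 :> S.
Proof.
by apply/eqP => /(congr1 (meval (pt 0 1)))/eqP; rewrite !mevalE meval0 oner_eq0.
Qed.

Lemma ell_neq0 : ell != 0.
Proof.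
apply/eqP => /(congr1 (meval (pt 0 1)))/eqP.
by rewrite !mevalE meval0 mulr0 add0r oner_eq0.
Qed.

Lemma arrF_neq0 : F != 0.
Proof. by rewrite mulf_neq0 ?X1_neq0 ?ell_neq0. Qed.

Lemma arrQ_neq0 : Q != 0.
Proof. by rewrite mulf_neq0 ?X0_neq0 ?arrF_neq0. Qed.

Lemma X0_ndvd : ~ mdvd ('X_0 : S) F.
Proof.
apply: (not_mdvd_meval (v := pt 0 1)); rewrite /arrF !mevalE //.
by rewrite mulr0 add0r mulr1 oner_eq0.
Qed.

Lemma X1_ndvd : ~ mdvd ('X_1 : S) ('X_0 * ell).
Proof.
apply: (not_mdvd_meval (v := pt 1 0)); rewrite !mevalE //.
by rewrite mulr1 addr0 mul1r.
Qed.

Lemma ell_ndvd : ~ mdvd ell ('X_0 * 'X_1).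
Proof.
apply: (not_mdvd_meval (v := pt 1 (- t))); rewrite !mevalE ?mulr1 ?subrr //.
by rewrite mul1r oppr_eq0.
Qed.

(** The three forms are prime and none divides the others, so they can be split off one after
    another. *)
Lemma arrQ_dvd p : mdvd 'X_0 p -> mdvd 'X_1 p -> mdvd ell p -> mdvd Q p.
Proof.
move=> x_p y_p [p1 pE].
have [|[p2 p1E]] : mdvd 'X_1 ell \/ mdvd 'X_1 p1 by apply: mprime_X1; rewrite -pE.
  by move/(mdvd_mull 'X_0)/X1_ndvd.
have [|[p3 p2E]] : mdvd 'X_0 F \/ mdvd 'X_0 p2.
- by apply: mprime_X0; move: x_p; rewrite pE p1E /arrF mulrCA mulrA.
- by move/X0_ndvd.
by exists p3; rewrite pE p1E p2E /arrQ /arrF; ring.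
Qed.

Lemma mderivF1 : F^`M(1) = t *: 'X_0 + 2%:R * 'X_1 :> S.
Proof.
by rewrite /arrF mderivM mderivD mderivZ !mderivX1 /= -!mul_mpolyC; ring.
Qed.

(* The hypotheses are congruences modulo each of the three lines. *)
Lemma arrQ_dvd_of_congr (v : S) :
  mdvd Q (3%:R * v - euler v) -> mdvd Q (F^`M(1) * v - F * v^`M(1)) -> mdvd Q v.
Proof.
have xQ : mdvd 'X_0 Q by exists F.
have yQ : mdvd 'X_1 Q by exists ('X_0 * ell); rewrite /arrQ /arrF mulrCA.
have lQ : mdvd ell Q by exists ('X_0 * 'X_1); rewrite /arrQ /arrF; ring.
rewrite mderivF1 => /(mdvd_trans xQ) Ex Dv.
have Dx := mdvd_trans xQ Dv; have Dy := mdvd_trans yQ Dv.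
have Dl := mdvd_trans lQ Dv.
have dvd_mul p q : mdvd p (p * q : S) by exists q.
apply: arrQ_dvd.
(* Modulo [x] the hypotheses read [3 v = y v_y] and [2 y v = y^2 v_y]; [y] times the first minus the
   second gives [y v = 0]. *)
- have [||//] := @mprime_X0 'X_1 v; last first.
    by move/(mdvd_mulr ell)/X0_ndvd.
  have -> : 'X_1 * v = 'X_1 * (3%:R * v - euler v)
     - ((t *: 'X_0 + 2%:R * 'X_1) * v - F * v^`M(1))
     + 'X_0 * (t *: v + 'X_1 * v^`M(0) - t *: 'X_1 * v^`M(1)).
    by rewrite /euler /arrF -!mul_mpolyC; ring.
  by apply: mdvdD => //; apply: mdvdB => //; apply: mdvd_mull.
(* Modulo [y], [F] vanishes and [F_y] equals [ell], so the second hypothesis times [x] gives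
   [x ell v = 0]. Modulo [ell], below, [F_y] equals [y] and the same argument gives [x y v = 0]. *)
- have [||//] := @mprime_X1 ('X_0 * ell) v; last by move/X1_ndvd.
  have -> : 'X_0 * ell * v = 'X_0 *
     ((t *: 'X_0 + 2%:R * 'X_1) * v - F * v^`M(1))
     + 'X_1 * ('X_0 * (ell * v^`M(1) - v)).
    by rewrite /arrF -!mul_mpolyC; ring.
  by apply: mdvdD => //; apply: mdvd_mull.
- have [||//] := @mprime_ell ('X_0 * 'X_1) v; last by move/ell_ndvd.
  have -> : 'X_0 * 'X_1 * v = 'X_0 *
     ((t *: 'X_0 + 2%:R * 'X_1) * v - F * v^`M(1))
     + ell * ('X_0 * ('X_1 * v^`M(1) - v)).
    by rewrite /arrF -!mul_mpolyC; ring.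
  by apply: mdvdD => //; apply: mdvd_mull.
Qed.

End Plane.

(** * Brackets with multiplications and the order of operators *)

Section Order.
Variable K : fieldType.
Local Notation S := {mpoly K[2]}.
Implicit Types (P R : endS K) (p q : S).

Definition comS P p : endS K := P * mulS p - mulS p * P.

Lemma mulS0 : mulS 0 = 0 :> endS K.
Proof. by apply: lendP => r; rewrite mulSE mul0r. Qed.

Lemma comSE P p r : comS P p r = P (p * r) - p * P r.
Proof. by []. Qed.

Lemma comS_mulSl q P p : comS (mulS q * P) p = mulS q * comS P p.
Proof. by apply: lendP => r; rewrite !(lendM, comSE, mulSE); ring. Qed.

Lemma comS_mulSr q P p : comS (P * mulS q) p = comS P p * mulS q.
Proof.
by apply: lendP => r; rewrite !(lendM, comSE, mulSE) [q * (p * r)]mulrCA.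
Qed.

Lemma diff_order_mulSl N p P : diff_order_lt N P -> diff_order_lt N (mulS p * P).
Proof.
elim: N P => [|N IH] P /=; first by move=> ->; rewrite mulr0.
by move=> HP q; rewrite -/(comS _ q) comS_mulSl; apply/IH/HP.
Qed.

Lemma diff_order_mulSr N p P : diff_order_lt N P -> diff_order_lt N (P * mulS p).
Proof.
elim: N P => [|N IH] P /=; first by move=> ->; rewrite mul0r.
by move=> HP q; rewrite -/(comS _ q) comS_mulSr; apply/IH/HP.
Qed.

Lemma diff_order_ltD N P R :
  diff_order_lt N P -> diff_order_lt N R -> diff_order_lt N (P + R).
Proof. by move=> HP HR; rewrite -[P]scale1r; apply: diff_order_ltP. Qed.

(** Left multiplication by [p] passes through brackets with multiplications, which reduces the claim
    to the injectivity of multiplication by [p] in a domain. *)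
Lemma diff_order_lt_cancel N p P :
  p != 0 -> diff_order_lt N (mulS p * P) -> diff_order_lt N P.
Proof.
move=> p0; elim: N P => [|N IH] P /= HP; last first.
  by move=> q; apply: IH; rewrite -/(comS _ q) -comS_mulSl; apply: HP.
apply: lendP => r; apply: (mulfI p0); rewrite lend0 mulr0.
by have := congr1 (fun A : endS K => A r) HP; rewrite lendM mulSE => ->.
Qed.

(** An operator that commutes with the variables is [S]-linear, hence determined by its value at
    1. *)
Lemma centralizer_mulS P : (forall i, comS P 'X_i = 0) -> P = mulS (P 1).
Proof.
move=> PX; suff H p q : P (p * q) = p * P q.
  by apply: lendP => p; rewrite -[p in LHS]mulr1 H mulSE mulrC.
elim/mpoly_alg_ind: p q => [c|i|p p' Hp Hp'|p p' Hp Hp'] q.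
- by rewrite mul_mpolyC linearZ /= mul_mpolyC.
- apply/eqP; rewrite -subr_eq0; apply/eqP.
  by have := congr1 (fun A : endS K => A q) (PX i); rewrite comSE.
- by rewrite mulrDl linearD /= Hp Hp' mulrDl.
- by rewrite -mulrA Hp Hp' mulrA.
Qed.

Lemma diff_order_lt1 P : diff_order_lt 1 P -> P = mulS (P 1).
Proof. by move=> HP; apply: centralizer_mulS => i; apply: HP. Qed.

(* On symbols this is the chain rule for the bracket with [p]. *)
Lemma diff_order_chain k P p : diff_order_lt k.+2 P ->
  diff_order_lt k (comS P p - mulS p^`M(0) * comS P 'X_0
                            - mulS p^`M(1) * comS P 'X_1).
Proof.
move=> HP; elim/mpoly_alg_ind: p => [c|i|p q Hp Hq|p q Hp Hq].
- rewrite !mderivC !mulS0 !mul0r !subr0.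
  have -> : comS P c%:MP = 0; last exact: diff_order_lt0.
  by apply: lendP => r; rewrite comSE !mul_mpolyC linearZ subrr.
- move: i; apply: ord2P; rewrite !mderivX1 /= ?mulr0n ?mulr1n mulS0 mul0r.
    have -> : mulS 1 = 1 :> endS K by apply: lendP => r; rewrite mulSE mul1r.
    by rewrite mul1r subrr subr0; apply: diff_order_lt0.
  have -> : mulS 1 = 1 :> endS K by apply: lendP => r; rewrite mulSE mul1r.
  by rewrite mul1r subr0 subrr; apply: diff_order_lt0.
- suff -> : comS P (p + q) - mulS (p + q)^`M(0) * comS P 'X_0
      - mulS (p + q)^`M(1) * comS P 'X_1 =
    (comS P p - mulS p^`M(0) * comS P 'X_0 - mulS p^`M(1) * comS P 'X_1) +
    (comS P q - mulS q^`M(0) * comS P 'X_0 - mulS q^`M(1) * comS P 'X_1).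
    exact: diff_order_ltD.
  apply: lendP => r; rewrite !(lendD, lendN, lendM, mulSE, comSE, mderivD).
  by rewrite [(p + q) * r]mulrDl linearD /=; ring.
(* The expression obeys the Leibniz rule up to the double bracket of [P] with [p] and [q], whose
   order is lower by two. *)
suff -> : comS P (p * q) - mulS (p * q)^`M(0) * comS P 'X_0
      - mulS (p * q)^`M(1) * comS P 'X_1 =
    mulS p *
      (comS P q - mulS q^`M(0) * comS P 'X_0 - mulS q^`M(1) * comS P 'X_1) +
    mulS q *
      (comS P p - mulS p^`M(0) * comS P 'X_0 - mulS p^`M(1) * comS P 'X_1) +
    comS (comS P p) q.
  apply: diff_order_ltD; last exact: HP.
  by apply: diff_order_ltD; apply: diff_order_mulSl.
apply: lendP => r; rewrite !(lendD, lendN, lendM, mulSE, comSE, mderivM).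
by rewrite !mulrA; ring.
Qed.

(* Euler's identity for the symbol of [P], homogeneous of degree [n]. *)
Lemma diff_order_euler n P : diff_order_lt n.+1 P ->
  diff_order_lt n (n%:R *: P - partialS K 0 * comS P 'X_0
                             - partialS K 1 * comS P 'X_1).
Proof.
elim: n P => [|n IH] P HP.
  have PX i : comS P 'X_i = 0 by apply: HP.
  by rewrite /= !PX !mulr0 scale0r !subr0.
move=> p; rewrite -/(comS _ p).
(* The bracket with [p] gives the same expression for [[P, p]], with [n] for [n.+1]; moving [p] past
   the partial derivatives produces the chain rule remainder, which absorbs the missing [[P, p]]. *)
suff -> : comS (n.+1%:R *: P - partialS K 0 * comS P 'X_0
      - partialS K 1 * comS P 'X_1) p =
    (n%:R *: comS P p - partialS K 0 * comS (comS P p) 'X_0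
      - partialS K 1 * comS (comS P p) 'X_1) +
    (comS P p - mulS p^`M(0) * comS P 'X_0 - mulS p^`M(1) * comS P 'X_1).
  by apply: diff_order_ltD; [apply/IH/HP | apply: diff_order_chain].
apply: lendP => r; rewrite [n.+1%:R]mulrS scalerDl scale1r.
rewrite !(lendD, lendN, lendM, lendZ, mulSE, comSE, partialSE).
rewrite /= (mulrCA p 'X_0 r) (mulrCA p 'X_1 r) !scaler_nat.
move: (P (_ * (_ * _))) (P (_ * (_ * _))) (P ('X_0 * r)) (P ('X_1 * r))
  (P (p * r)) (P r) => a0 a1 b0 b1 c d.
rewrite !(mderivB, mderivM) !mderivX1 /=. ring.
Qed.

End Order.

(** * The algebra [U] and derivations determined by their values on generators *)

Section Operators.
Variables (K : fieldType) (t : K).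
Hypotheses (char0 : [pchar K] =i pred0) (t_neq0 : t != 0).
Local Notation S := {mpoly K[2]}.
Local Notation F := (arrF t).
Local Notation Q := (arrQ t).
Local Notation U := (Diff t).
Local Notation mulU := (diff_mul Q).
Local Notation x := (opx t).
Local Notation y := (opy t).
Local Notation D := (opD t).
Local Notation E := (opE t).
Implicit Types (P R : U) (p q : S) (d e : derivation U).

Lemma diffP P R : (forall r, P r = R r) -> P = R.
Proof. by move=> PR; apply: val_inj; apply: lendP. Qed.

Lemma diffM P R r : (P * R) r = P (R r). Proof. by []. Qed.
Lemma diffD P R r : (P + R) r = P r + R r. Proof. by []. Qed.
Lemma diffN P r : (- P) r = - P r. Proof. by []. Qed.
Lemma diffZ c P r : (c *: P) r = c *: P r. Proof. by []. Qed.
Lemma diff0 r : (0 : U) r = 0. Proof. by []. Qed.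
Lemma diff1 r : (1 : U) r = r. Proof. by []. Qed.
Lemma diff_mulE p r : mulU p r = p * r. Proof. by []. Qed.
Lemma opEE r : E r = euler r. Proof. by []. Qed.
Lemma opDE r : D r = F * r^`M(1). Proof. by []. Qed.
Definition diffE := (diffM, diffD, diffN, diffZ, diff0, diff1, diff_mulE, opDE, opEE).

Lemma diff_mulM p q : mulU (p * q) = mulU p * mulU q.
Proof. by apply: diffP => r; rewrite !diffE mulrA. Qed.

Lemma diff_mul_is_linear : linear mulU.
Proof. by move=> c p q; apply: diffP => r; rewrite !diffE mulrDl scalerAl. Qed.

HB.instance Definition _ := GRing.isLinear.Build K S U *:%R mulU diff_mul_is_linear.

Lemma diff_mulC c : mulU c%:MP = c *: 1.
Proof. by apply: diffP => r; rewrite !diffE mul_mpolyC. Qed.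

Lemma diff_ord P : exists n, diff_order_lt n (val P).
Proof. by have /asboolP[] := diff_valP P. Qed.

Lemma diff_stable P n p : mdvd (Q ^+ n) (P (Q ^+ n * p)).
Proof. by have /asboolP[_ /(_ n p)] := diff_valP P. Qed.

Definition comU P p : U := P * mulU p - mulU p * P.

Lemma comUE P p r : comU P p r = P (p * r) - p * P r.
Proof. by []. Qed.

Lemma comU_order P p n : diff_order_lt n.+1 (val P) -> diff_order_lt n (val (comU P p)).
Proof. by apply. Qed.

Lemma diff_mulP P : (forall i, comU P 'X_i = 0) -> P = mulU (P 1).
Proof.
move=> PX; apply: val_inj; apply: centralizer_mulS => i.
by have /(congr1 val) := PX i.
Qed.

Lemma natr_neq0 n : n.+1%:R != 0 :> K.
Proof. by rewrite ((pcharf0P K).1 char0). Qed.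

Lemma derD d e P : (d + e) P = d P + e P. Proof. by []. Qed.
Lemma derN d P : (- d) P = - d P. Proof. by []. Qed.
Lemma derZ c d P : (c *: d) P = c *: d P. Proof. by []. Qed.
Lemma der0 P : (0 : derivation U) P = 0. Proof. by []. Qed.
Lemma adE R P : ad R P = R * P - P * R. Proof. by []. Qed.
Definition derE := (derD, derN, derZ, der0, adE).

Lemma derivation1 d : d 1 = 0.
Proof.
have := derivation_leibniz d 1 1; rewrite !mul1r mulr1 => /eqP.
by rewrite -subr_eq subrr eq_sym => /eqP.
Qed.

Lemma derivation_mul0 d : d x = 0 -> d y = 0 -> forall p, d (mulU p) = 0.
Proof.
move=> dx dy p; elim/mpoly_alg_ind: p => [c|i|p q Hp Hq|p q Hp Hq].
- by rewrite diff_mulC linearZ /= derivation1 scaler0.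
- by move: i; apply: ord2P.
- by rewrite linearD linearD /= Hp Hq addr0.
- by rewrite diff_mulM derivation_leibniz Hp Hq mulr0 mul0r addr0.
Qed.

Lemma derivation_eq0 d : d x = 0 -> d y = 0 -> d D = 0 -> d E = 0 -> d = 0.
Proof.
move=> dx dy dD dE; have dS := derivation_mul0 dx dy.
suff H n P : diff_order_lt n (val P) -> d P = 0.
  by apply: val_inj; apply: lendP => P; have [n /H] := diff_ord P.
elim: n P => [|[|n] IH] P HP.
- by have -> : P = 0 by [apply: val_inj]; rewrite linear0.
- by rewrite (_ : P = mulU (P 1)) ?dS //; apply: val_inj; apply: diff_order_lt1.
(* [X] and [Y] are [Q] times the two partial derivatives, written in the generators so that [d]
   kills them. *)
pose X : U := mulU F * E - y * D; pose Y : U := x * D.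
have dX : d X = 0.
  by rewrite linearB /= !derivation_leibniz dS dy dE dD !mulr0 !mul0r addr0 subr0.
have dY : d Y = 0 by rewrite derivation_leibniz dx dD mulr0 mul0r addr0.
have XE r : X r = Q * r^`M(0) by rewrite !diffE /euler /arrQ; ring.
have YE r : Y r = Q * r^`M(1) by rewrite !diffE /arrQ mulrA.
pose R : U := n.+1%:R *: (mulU Q * P) - X * comU P 'X_0 - Y * comU P 'X_1.
have R_order : diff_order_lt n.+1 (val R).
  suff -> : val R = mulS Q * (n.+1%:R *: (val P) - partialS K 0 * comS (val P) 'X_0
                             - partialS K 1 * comS (val P) 'X_1).
    exact/diff_order_mulSl/diff_order_euler.
  apply: lendP => r; transitivity (n.+1%:R *: (Q * P r)
      - X (comU P 'X_0 r) - Y (comU P 'X_1 r)) => //; rewrite XE YE /=.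
  by rewrite !mulrBr scalerAr.
(* By induction [d] vanishes on [R] and on the brackets of [P], so [n.+1 * Q * d P = 0]; both
   factors in front of [d P] can be cancelled. *)
have := IH _ R_order; rewrite {}/R in R_order *; clearbody X Y.
rewrite !linearB linearZ /= !derivation_leibniz.
rewrite dX dY dS !(IH _ (comU_order _ _)) // !mulr0 !mul0r !addr0 !subr0 add0r.
move=> /(congr1 val) H; apply: val_inj; apply: lendP => r.
have /eqP := congr1 (fun A : endS K => A r) H.
rewrite /= scaler_eq0 (negPf (natr_neq0 _)) /= mulf_eq0 (negPf (arrQ_neq0 t)).
by move/eqP.
Qed.


(** * The operator [u] whose bracket with multiplications is [d] *)

Section Potential.
Variable d : derivation U.

(* [d] is the commutator with this operator on the multiplications, so it is
   inner as soon as the operator is in [U]. *)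
Definition potential_fun p : S := d (mulU p) 1.

Lemma potential_is_linear : linear potential_fun.
Proof. by move=> c p q; rewrite /potential_fun !linearP. Qed.

HB.instance Definition _ := GRing.isLinear.Build K S S *:%R potential_fun
  potential_is_linear.

Definition potential : endS K := [the {linear S -> S} of potential_fun].
Local Notation u := potential.

(** The Leibniz rule evaluated at 1; it says that [[u, p] = d p] for multiplication by [p]. *)
Lemma potentialM p r : u (p * r) = p * u r + d (mulU p) r.
Proof.
rewrite /= /potential_fun diff_mulM derivation_leibniz !diffE mulr1.
by rewrite addrC.
Qed.

(** The brackets [[u, p] = d p] need a bound on their order uniform in [p]: by the Leibniz rule, the
    orders of [d x] and [d y] provide one. *)
Lemma potential_order : exists n, diff_order_lt n u.
Proof.
have [n0 Hx] := diff_ord (d x); have [n1 Hy] := diff_ord (d y).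
exists (maxn n0 n1).+1 => p; rewrite -/(comS _ p).
have -> : comS u p = val (d (mulU p)).
  by apply: lendP => r; rewrite comSE potentialM addrAC subrr add0r.
elim/mpoly_alg_ind: p => [c|i|p q Hp Hq|p q Hp Hq].
- by rewrite diff_mulC linearZ /= derivation1 scaler0; apply: diff_order_lt0.
- move: i; apply: ord2P.
    exact: diff_order_lt_le (leq_maxl _ _) Hx.
  exact: diff_order_lt_le (leq_maxr _ _) Hy.
- by rewrite 2!linearD; apply: diff_order_ltD.
rewrite diff_mulM derivation_leibniz.
by apply: diff_order_ltD; [apply: diff_order_mulSr | apply: diff_order_mulSl].
Qed.

(** Since [[R, x_i]] is a multiplication, on which [d] and the bracket with [u] agree, [d R -
    [u, R]] commutes with the variables and is a multiplication. *)
Lemma potential_vector_field R :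
  (forall p r, R (p * r) = R p * r + p * R r) ->
  exists s, forall r, d R r = u (R r) - R (u r) + s * r.
Proof.
move=> RM; pose A : endS K := val (d R) - (u * val R - val R * u).
exists (A 1) => r; suff AE : A = mulS (A 1).
  have : A r = A 1 * r by rewrite {1}AE.
  by move=> <-; rewrite [A r]/= addrC subrK.
apply: centralizer_mulS => i; apply: lendP => {}r.
have RX : R * mulU 'X_i - mulU 'X_i * R = mulU (R 'X_i).
  by apply: diffP => p; rewrite !diffE RM addrK.
have H : d (mulU (R 'X_i)) r = d R ('X_i * r) + R (d (mulU 'X_i) r)
    - (d (mulU 'X_i) (R r) + 'X_i * d R r).
  by rewrite -RX linearB !derivation_leibniz !diffE.
have AE p : A p = d R p - (u (R p) - R (u p)) by [].
rewrite comSE !AE RM [u (_ + _)]linearD !potentialM [R (_ + _)]linearD RM H lend0; ring.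
Qed.

Lemma vector_fieldX R c n v :
  (forall p r, R (p * r) = R p * r + p * R r) -> R Q = c * Q ->
  R (Q ^+ n * v) = Q ^+ n * (n%:R * c * v + R v).
Proof.
move=> RM RQ; elim: n v => [|n IH] v; first by rewrite !expr0 !mul1r mulr0n !mul0r add0r.
by rewrite exprSr -mulrA IH RM RQ -natr1; ring.
Qed.

(* The class [v] of [u (Q ^+ n.+1) / Q ^+ n] modulo [Q] is an eigenvector of the
   residues of [R], as [[u, R]] is in [U] up to a multiplication. *)
Lemma potential_residue R c n v :
  (forall p r, R (p * r) = R p * r + p * R r) -> R Q = c * Q ->
  u (Q ^+ n.+1) = Q ^+ n * v -> mdvd Q (c * v - R v).
Proof.
move=> RM RQ uv; have [s dR] := potential_vector_field RM.
have := dR (Q ^+ n.+1).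
have [k dRQ] := diff_stable (d R) n.+1 1.
have [l dcQ] := diff_stable (d (mulU (n.+1%:R * c))) n.+1 1.
have RQn : R (Q ^+ n.+1) = n.+1%:R * c * Q ^+ n.+1.
  have := vector_fieldX n.+1 1 RM RQ; rewrite !mulr1 => ->.
  have -> : R 1 = 0.
    have := RM 1 1; rewrite !mulr1 !mul1r => /eqP.
    by rewrite -subr_eq subrr eq_sym => /eqP.
  by rewrite addr0 mulrC.
rewrite mulr1 in dRQ; rewrite mulr1 in dcQ.
(* The coefficients [n.+1 * c] and [n * c] differ by [c], so modulo [Q ^+ n.+1] there remains
   [Q ^+ n * (c * v - R v)]. *)
rewrite dRQ RQn potentialM dcQ uv (vector_fieldX n v RM RQ) => H.
exists (k - l - s); apply: (mulfI (expf_neq0 n (arrQ_neq0 t))).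
rewrite mulrA -exprSr !mulrBr H -natr1 exprSr; ring.
Qed.

(** As [[u, p]] is in [U], the case [p = 1] suffices. By induction [u (Q ^+ n.+1)] is [Q ^+ n * v]
    for some [v], and the residues of [E] and [D] supply the congruences that force [Q] to divide
    [v]. *)
Lemma potential_stable n p : mdvd (Q ^+ n) (u (Q ^+ n * p)).
Proof.
rewrite mulrC potentialM; apply: mdvdD; first last.
  by have := diff_stable (d (mulU p)) n 1; rewrite mulr1.
apply: mdvd_mull; elim: n => [|n [w uw]].
  by rewrite expr0; exists (u 1); rewrite mul1r.
have [w' dQ] := diff_stable (d (mulU Q)) n 1; rewrite mulr1 in dQ.
have uv : u (Q ^+ n.+1) = Q ^+ n * (Q * w + w').
  by rewrite exprS potentialM uw dQ; ring.
have EM p' r : E (p' * r) = E p' * r + p' * E r.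
  by rewrite !diffE /euler !mderivM; ring.
have DM p' r : D (p' * r) = D p' * r + p' * D r by rewrite !diffE !mderivM; ring.
have EQ : E Q = 3%:R * Q.
  rewrite !diffE /euler /arrQ /arrF.
  by rewrite !(mderivM, mderivD, mderivZ, mderivX1) /= -!mul_mpolyC; ring.
have DQ : D Q = F^`M(1) * Q by rewrite !diffE /arrQ mderivM mderivX1 /=; ring.
have [||v' ve] := arrQ_dvd_of_congr t_neq0 (v := Q * w + w').
- by have := potential_residue EM EQ uv. 
- by have := potential_residue DM DQ uv; rewrite diffE.
by rewrite uv ve exprSr mulrA; exists v'.
Qed.

Fact potential_subproof : potential \in diff_pred Q.
Proof.
by apply/asboolP; split; [exact: potential_order | exact: potential_stable].
Qed.

Definition potentialU : U := DiffArr potential_subproof.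

Lemma diff_valE r : potentialU r = u r. Proof. by []. Qed.

Lemma sub_ad_mulU p : (d - ad potentialU) (mulU p) = 0.
Proof.
rewrite derD derN adE; apply: diffP => r; rewrite !diffE diff_valE potentialM.
by rewrite [p * u r + _]addrC addrK subrr.
Qed.

End Potential.

(** * Polynomials over [U] and their values at natural numbers *)

Lemma diff_natE k r : (k%:R : U) r = k%:R * r.
Proof.
elim: k => [|k IH]; first by rewrite !mulr0n diff0 mul0r.
by rewrite !mulrS diffD IH diff1 mulrDl mul1r.
Qed.

Lemma diff_sumE m (G : 'I_m -> U) r : (\sum_(i < m) G i) r = \sum_(i < m) G i r.
Proof. by elim/big_rec2: _ => [|i _ P _ <-]. Qed.

Lemma mpoly_natr_inj : injective (fun n : nat => n%:R : S).
Proof.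
suff H i j : (i < j)%N -> i%:R != j%:R :> S.
  by move=> i j /eqP; case: (ltngtP i j) => // /H; rewrite 1?eq_sym => /negPf ->.
move=> lt_ij; rewrite -subr_eq0 -opprB oppr_eq0 -natrB ?(ltnW lt_ij) //.
case: (j - i)%N (subn_gt0 i j) => [|k _]; first by rewrite lt_ij.
by rewrite -mpolyC_nat mpolyC_eq0 natr_neq0.
Qed.

Lemma comm_poly_nat (c : {poly U}) n : comm_poly c n%:R.
Proof. by rewrite /comm_poly mulr_natl mulr_natr. Qed.

(** [U] is not commutative, so the coefficients are applied to a fixed [r]: the resulting polynomial
    over the domain [S] has more roots than its degree, the natural numbers being distinct in
    [S]. *)
Lemma poly_natr_eq0 (c : {poly U}) : (forall n, c.[n%:R] = 0) -> c = 0.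
Proof.
move=> c0; apply/polyP => i; rewrite coef0; apply: diffP => r.
pose q := \poly_(i < size c) (c`_i r : S).
suff q0 : q = 0.
  have := congr1 (fun q : {poly S} => q`_i) q0.
  rewrite coef_poly coef0; case: ltnP => // lei _.
  by rewrite nth_default.
apply/eqP/negPn/negP => q0.
have := @max_poly_roots _ q [seq n%:R | n <- iota 0 (size q)] q0.
rewrite size_map size_iota ltnn => H; suff: false by []; apply: H.
  apply/allP => _ /mapP[n _ ->]; apply/eqP.
  transitivity (c.[n%:R] r); last by rewrite c0.
  rewrite horner_poly horner_coef diff_sumE.
  apply: eq_bigr => k _.
  by rewrite diffM -!natrX diff_natE mulr_natl linearMn mulr_natr.
rewrite map_inj_uniq ?iota_uniq //; exact: mpoly_natr_inj.
Qed.

(** The binomial coefficient ['X] choose [i] as a polynomial. *)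
Definition binp i : {poly K} := i`!%:R^-1 *: \prod_(j < i) ('X - j%:R%:P).

Lemma hornerK_binp n i : (binp i).[n%:R] = 'C(n, i)%:R.
Proof.
have i0 : i`!%:R != 0 :> K by case: i`! (fact_gt0 i) => // k _; apply: natr_neq0.
apply: (mulfI i0); rewrite hornerZ mulrA mulfV // mul1r -natrM mulnC bin_ffact.
rewrite horner_prod ffact_prod natr_prod.
case: (leqP i n) => [le_in|lt_ni].
  apply: eq_bigr => j _; rewrite !hornerE natrB //.
  by apply: leq_trans le_in; apply: ltnW.
(* For [n < i] the factor at [j = n] vanishes on both sides. *)
rewrite (bigD1 (Ordinal lt_ni)) //= !hornerE subrr mul0r.
by rewrite [RHS](bigD1 (Ordinal lt_ni)) //= subnn mul0r.
Qed.

Lemma horner_binp n i : (map_poly (in_alg U) (binp i)).[n%:R] = 'C(n, i)%:R.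
Proof.
by rewrite -[n%:R](rmorph_nat (in_alg U)) horner_map hornerK_binp /= scaler_nat.
Qed.

(** * Conjugation by a line [f] and its logarithm *)

Section Logarithm.
Variables f g : S.
Hypotheses (Q_fg : Q = f * g) (f_prime : mprime f) (f_ndvd : ~ mdvd f g).

Lemma line_neq0 : f != 0.
Proof. by have := arrQ_neq0 t; rewrite Q_fg mulf_eq0 negb_or => /andP[]. Qed.

(** Induction on the order of [P]. Write [P (f * Q ^+ n * p)] as [Q ^+ n * r]; the induction
    hypothesis for [[P, g]] and the stability of [Q ^+ n.+1] show that [f] divides [g * r], hence
    [r], as [f] is prime and does not divide [g]. *)
Lemma line_stable P n p : mdvd (f * Q ^+ n) (P (f * Q ^+ n * p)).
Proof.
have [N] := diff_ord P; elim: N P p => [|N IH] P p HP.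
  by rewrite (_ : P = 0) ?diff0; [exists 0; rewrite mulr0 | apply: val_inj].
have [r Pr] := diff_stable P n (f * p).
have [k Pk] := diff_stable P n.+1 p.
have [l Pl] := IH (comU P g) p (comU_order _ HP).
have Qn0 : Q ^+ n != 0 by rewrite expf_neq0 ?arrQ_neq0.
rewrite mulrAC [f * p * _]mulrC Pr.
have [||[s ->]] := f_prime (p := g) (q := r); last by exists s; ring.
- exists (g * k - l); apply: (mulfI Qn0).
  have := comUE P g (f * Q ^+ n * p); rewrite Pl.
  have -> : g * (f * Q ^+ n * p) = Q ^+ n.+1 * p by rewrite exprS {2}Q_fg; ring.
  rewrite Pk [f * Q ^+ n * p](_ : _ = Q ^+ n * (f * p)); last by ring.
  rewrite Pr => H; apply/eqP; rewrite -subr_eq0 -oppr_eq0; apply/eqP.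
  transitivity (Q ^+ n.+1 * k - g * (Q ^+ n * r) - f * Q ^+ n * l).
    by rewrite exprS Q_fg; ring.
  by rewrite -H subrr.
- by [].
Qed.

Lemma line_dvd P p : exists q, P (f * p) = f * q.
Proof. by have := line_stable P 0 p; rewrite expr0 mulr1. Qed.

Definition conj_fun P p : S := sval (cid (line_dvd P p)).

Lemma conj_funE P p : f * conj_fun P p = P (f * p).
Proof. by rewrite /conj_fun; case: cid => q /=. Qed.

Lemma conj_fun_is_linear P : linear (conj_fun P).
Proof.
move=> c p q; apply: (mulfI line_neq0); rewrite conj_funE.
by rewrite mulrDr -!scalerAr linearP /= -!conj_funE mulrDr scalerAr.
Qed.

HB.instance Definition _ P := GRing.isLinear.Build K S S *:%R (conj_fun P)
  (conj_fun_is_linear P).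

Definition conjS P : endS K := [the {linear S -> S} of conj_fun P].

Lemma conjSE P p : f * conjS P p = P (f * p). Proof. exact: conj_funE. Qed.

Fact conj_subproof P : conjS P \in diff_pred Q.
Proof.
apply/asboolP; split.
  have [n HP] := diff_ord P; exists n; apply: (diff_order_lt_cancel line_neq0).
  have -> : mulS f * conjS P = val P * mulS f.
    by apply: lendP => r; rewrite lendM mulSE conjSE.
  exact: diff_order_mulSr.
move=> n p; have [k Pk] := line_stable P n p.
by exists k; apply: (mulfI line_neq0); rewrite conjSE mulrA Pk mulrA.
Qed.

(* [f^-1 P f] *)
Definition conj P : U := DiffArr (conj_subproof P).

Lemma conjE P p : f * conj P p = P (f * p). Proof. exact: conj_funE. Qed.

Lemma conj_eq P R : (forall p, P (f * p) = f * R p) -> conj P = R.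
Proof. by move=> PR; apply: diffP => p; apply: (mulfI line_neq0); rewrite conjE. Qed.

Lemma conj_is_linear : linear conj.
Proof.
move=> c P R; apply: conj_eq => p.
by rewrite !diffE mulrDr -!scalerAr !conjE.
Qed.

HB.instance Definition _ := GRing.isLinear.Build K U U *:%R conj conj_is_linear.

Lemma conjM P R : conj (P * R) = conj P * conj R.
Proof. by apply: conj_eq => p; rewrite !diffM conjE conjE. Qed.

Definition conjL : lend U := [the {linear U -> U} of conj].

Lemma conjL_exprM n P R : (conjL ^+ n) (P * R) = (conjL ^+ n) P * (conjL ^+ n) R.
Proof.
elim: n => [|n IH]; first by rewrite expr0.
by rewrite exprS !lendM IH; apply: conjM.
Qed.

(** [f * (conj P - P)] is the bracket [[P, f]], so [conj - 1] lowers the order. *)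
Lemma conjL_nilp P n : diff_order_lt n (val P) -> ((conjL - 1) ^+ n) P = 0.
Proof.
elim: n P => [|n IH] P HP; first by rewrite expr0 lend1; apply: val_inj.
rewrite exprSr lendM IH //; apply: (diff_order_lt_cancel line_neq0).
have -> : mulS f * val ((conjL - 1) P) = val (comU P f); last exact: comU_order.
by apply: lendP => r; rewrite lendM mulSE comUE -conjE -mulrBr.
Qed.

Definition diff_bound P := sval (cid (diff_ord P)).

(** The binomial series of [conj = 1 + (conj - 1)] raised to the power ['X], applied to [P];
    nilpotency allows truncation at the order of [P]. *)
Definition conj_poly P : {poly U} := \sum_(i < diff_bound P)
  map_poly (in_alg U) (binp i) * (((conjL - 1) ^+ i) P)%:P.

Lemma horner_conj_poly P n : (conj_poly P).[n%:R] = (conjL ^+ n) P.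
Proof.
have H : diff_order_lt (diff_bound P) (val P).
  by rewrite /diff_bound; case: cid.
have nil i : (diff_bound P <= i)%N -> ((conjL - 1) ^+ i) P = 0.
  by move=> /diff_order_lt_le/(_ H)/conjL_nilp.
rewrite /conj_poly horner_sum -[conjL in RHS](subrK 1) exprD1n.
have sumE m (G : 'I_m -> lend U) : (\sum_(i < m) G i) P = \sum_(i < m) G i P.
  by elim/big_rec2: _ => [|i _ v _ <-].
rewrite sumE; set b := diff_bound P in nil *.
transitivity (\sum_(i < b) ((conjL - 1) ^+ i) P *+ 'C(n, i)).
  apply: eq_bigr => i _; rewrite hornerM_comm; last exact: comm_poly_nat.
  by rewrite horner_binp hornerC mulr_natl.
transitivity (\sum_(i < n.+1) ((conjL - 1) ^+ i) P *+ 'C(n, i)); last first.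
  by apply: eq_bigr => i _; elim: 'C(n, i) => // k IH; rewrite !mulrSr IH.
(* Both sums extend to the larger range: terms beyond [b] vanish by nilpotency, terms beyond [n] by
   their binomial coefficient. *)
rewrite (big_ord_widen _ (fun i => ((conjL - 1) ^+ i) P *+ 'C(n, i))
  (leq_maxl b n.+1)).
rewrite [RHS](big_ord_widen _ (fun i => ((conjL - 1) ^+ i) P *+ 'C(n, i))
  (leq_maxr b n.+1)).
rewrite big_mkcond [RHS]big_mkcond; apply: eq_bigr => i _.
case: ltnP => [_|/nil ->]; last by rewrite mul0rn if_same.
by case: ltnP => // /bin_small ->.
Qed.

Lemma conj_poly_eq P (c : {poly U}) :
  (forall n, c.[n%:R] = (conjL ^+ n) P) -> conj_poly P = c.
Proof.
move=> cP; apply/eqP; rewrite -subr_eq0; apply/eqP/poly_natr_eq0 => n.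
by rewrite hornerD hornerN horner_conj_poly cP subrr.
Qed.

(** Both sides agree at all natural numbers, where the iterates of [conj] are multiplicative and
    evaluation is too because naturals are central. *)
Lemma conj_polyM P R : conj_poly (P * R) = conj_poly P * conj_poly R.
Proof.
apply: conj_poly_eq => n; rewrite hornerM_comm; last exact: comm_poly_nat.
by rewrite !horner_conj_poly conjL_exprM.
Qed.

Lemma conj_polyP c P R :
  conj_poly (c *: P + R) = (c *: 1)%:P * conj_poly P + conj_poly R.
Proof.
apply: conj_poly_eq => n; rewrite hornerD hornerM_comm; last exact: comm_poly_nat.
by rewrite hornerC !horner_conj_poly -scalerAl mul1r linearP.
Qed.

Lemma conj_poly_affine P R :
  conj P = P + R -> conj R = R -> conj_poly P = P%:P + R%:P * 'X.
Proof.
move=> PR RR; apply: conj_poly_eq => n; rewrite hornerD hornerMX !hornerC.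
elim: n => [|n IH]; first by rewrite mulr0 addr0.
rewrite exprS lendM -IH /= linearD /= PR.
have -> : conj (R * n%:R) = R * n%:R by rewrite mulr_natr linearMn /= RR.
by rewrite mulrS mulrDr mulr1 addrA.
Qed.

Lemma conj_poly0 P : (conj_poly P)`_0 = P.
Proof. by rewrite -horner_coef0 (horner_conj_poly P 0). Qed.

(* The logarithm of the conjugation by [f], formally the bracket with [log f]. *)
Definition dlog_fun P : U := (conj_poly P)`_1.

Lemma dlog_is_linear : linear dlog_fun.
Proof.
by move=> c P R; rewrite /dlog_fun conj_polyP coefD coefCM -scalerAl mul1r.
Qed.

HB.instance Definition _ := GRing.isLinear.Build K U U *:%R dlog_fun dlog_is_linear.

Definition dlogL : lend U := [the {linear U -> U} of dlog_fun].

(** The coefficient of ['X] in a product obeys the Leibniz rule relative to the constant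
    coefficients, here [P] and [R]. *)
Fact dlog_subproof : dlogL \in @derivation_pred K U.
Proof.
apply/asboolP => P R; rewrite /= /dlog_fun conj_polyM coefM.
by rewrite !big_ord_recl big_ord0 addr0 /= !conj_poly0 addrC.
Qed.

Definition dlog : derivation U := Derivation dlog_subproof.

Lemma dlog_affine P R : conj P = P + R -> conj R = R -> dlog P = R.
Proof.
move=> PR RR; have -> : dlog P = (conj_poly P)`_1 by [].
by rewrite (conj_poly_affine PR RR) coefD coefC coefMX coefC add0r.
Qed.

Lemma conj_mul p : conj (mulU p) = mulU p.
Proof. by apply: conj_eq => r; rewrite !diffE mulrCA. Qed.

Lemma dlog_mul p : dlog (mulU p) = 0.
Proof. by apply: dlog_affine; rewrite ?addr0 ?linear0 ?conj_mul. Qed.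

(** Conjugation by [f] fixes [S] and adds to a vector field its value on [f] divided by [f]: [q] for
    [D] and 1 for [E]. As these summands are fixed, they are the values of the logarithm. *)
Lemma is_partial_dlog q : euler f = f -> f * q = F * f^`M(1) -> is_partial f dlog.
Proof.
move=> fE fq; split; [exact: dlog_mul | exact: dlog_mul | |].
  exists q => //; apply: dlog_affine; last exact: conj_mul.
  by apply: conj_eq => r; rewrite !diffE mderivM mulrDr [F * (_ * r)]mulrA -fq; ring.
have c1 : conj 1 = 1 by apply: conj_eq => r; rewrite !diff1.
apply: dlog_affine => //; apply: conj_eq => r; rewrite !diffE.
have -> : euler (f * r) = euler f * r + f * euler r.
  by rewrite /euler !mderivM; ring.
by rewrite fE; ring.
Qed.

End Logarithm.

(** * Image and eigenspaces of the Euler operator in characteristic zero *)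

Lemma euler_decomp p : exists h c, p = euler h + c%:MP.
Proof.
elim/mpolyind: p => [|c m p _ _ [h [c' ->]]].
  by exists 0, 0; rewrite mpolyC0 /euler !mderiv0 !mulr0 !addr0.
have eD r s : euler (r + s) = euler r + euler s :> S.
  by rewrite /euler !mderivD; ring.
have [m0|] := posnP (mdeg m).
  exists h, (c + c'); move/eqP: m0; rewrite mdeg_eq0 => /eqP ->.
  by rewrite mpolyX0 alg_mpolyC mpolyCD addrCA.
case mk: (mdeg m) => [|k] // _.
(* In degree [k.+1] the Euler operator is multiplication by [k.+1], which is invertible. *)
exists ((k.+1%:R^-1 * c) *: 'X_[m] + h), c'; rewrite eD addrA; congr (_ + _ + _).
apply/mpolyP => m'; rewrite mcoeff_euler !mcoeffZ mcoeffX.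
case: eqP => [<-|_]; last by rewrite !mulr0.
by rewrite mk !mulr1 mulrA mulfV ?mul1r ?natr_neq0.
Qed.

Lemma euler_eq0 p : euler p = 0 -> p = (p@_0)%:MP.
Proof.
move=> p0; apply/mpolyP => m; rewrite mcoeffC.
case: (eqVneq m 0%MM) => [->|m0]; first by rewrite /= mulr1.
rewrite /= mulr0.
have := mcoeff_euler p m; rewrite p0 mcoeff0 => /esym/eqP.
rewrite mulf_eq0; case/orP => [|/eqP //].
case: (mdeg m) (mdeg_eq0 m) => [|k _]; last by rewrite (negPf (natr_neq0 _)).
by rewrite (negPf m0).
Qed.

Lemma euler_linear p :
  euler p = p -> p = p@_U_(0) *: 'X_0 + p@_U_(1) *: 'X_1.
Proof.
move=> pE; apply/mpolyP => m; rewrite mcoeffD !mcoeffZ !mcoeffX.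
have [/eqP|m1] := eqVneq (mdeg m) 1%N.
  rewrite mdeg_eq1 => /existsP[i /eqP ->]; move: i.
  by apply: ord2P; rewrite !eq_mnm1 /= !(mulr1, mulr0) ?addr0 ?add0r.
have -> : p@_m = 0.
  have := mcoeff_euler p m; rewrite pE => /eqP.
  rewrite -[X in X == _]mul1r -subr_eq0 -mulrBl mulf_eq0 => /orP[|/eqP //].
  case: (mdeg m) m1 => [|[|k]] // _; first by rewrite subr0 oner_eq0.
  by rewrite -natr1 opprD addrCA subrr addr0 oppr_eq0 (negPf (natr_neq0 _)).
have ne i : (U_(i)%MM == m) = false by apply: contraNF m1 => /eqP <-; rewrite mdeg1.
by rewrite !ne !mulr0 addr0.
Qed.

(** Apply [d] to the relation [[E, D] = D] and evaluate at 1. *)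
Lemma eulerE_rel d (e g : S) :
  d E = mulU e -> d D = mulU g -> euler g - F * e^`M(1) = g.
Proof.
have [_ [_ _ /(congr1 d)]] := Diff_relations t.
rewrite linearB /= !derivation_leibniz => + dE dD; rewrite dE dD.
move=> /(congr1 (fun P : U => P 1)); rewrite !diffE /euler !mderivM.
have d1 i : (1 : S)^`M(i) = 0 by rewrite -mpolyC1 mderivC.
by rewrite !d1 !mulr0 !addr0 !mulr1 !mulr0 !add0r.
Qed.

(** * The three classes form a basis of the outer derivations *)

Section Generators.
Variables d1 d2 d3 : derivation U.
Hypotheses (d1P : is_partial 'X_0 d1) (d2P : is_partial 'X_1 d2)
  (d3P : is_partial (t *: 'X_0 + 'X_1) d3).

Lemma d1D : d1 D = 0.
Proof.
case: d1P => _ _ [g xg ->] _; suff -> : g = 0 by rewrite linear0.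
by apply: (mulfI (X0_neq0 K)); rewrite xg mderivX1 mulr0n !mulr0.
Qed.

Lemma d2D : d2 D = mulU (t *: 'X_0 + 'X_1).
Proof.
case: d2P => _ _ [g yg ->] _; congr mulU.
by apply: (mulfI (X1_neq0 K)); rewrite yg mderivX1 mulr1.
Qed.

Lemma d3D : d3 D = mulU 'X_1.
Proof.
case: d3P => _ _ [g lg ->] _; congr mulU; apply: (mulfI (ell_neq0 t)).
by rewrite lg mderivD mderivZ !mderivX1 scaler0 add0r mulr1 mulrC.
Qed.

Definition comb (a b c : K) : derivation U := a *: d1 + b *: d2 + c *: d3.

Lemma combx a b c : comb a b c x = 0.
Proof.
case: d1P d2P d3P => + _ _ _ [+ _ _ _] [+ _ _ _] => x1 x2 x3.
by rewrite /comb !derE x1 x2 x3 !scaler0 !addr0.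
Qed.

Lemma comby a b c : comb a b c y = 0.
Proof.
case: d1P d2P d3P => _ + _ _ [_ + _ _] [_ + _ _] => x1 x2 x3.
by rewrite /comb !derE x1 x2 x3 !scaler0 !addr0.
Qed.

Lemma combD a b c : comb a b c D = mulU ((b * t) *: 'X_0 + (b + c) *: 'X_1).
Proof.
rewrite /comb !derE d1D d2D d3D scaler0 add0r -!linearZ -linearD /=.
by congr mulU; rewrite scalerDr scalerA scalerDl addrA.
Qed.

Lemma combE a b c : comb a b c E = mulU (a + b + c)%:MP.
Proof.
case: d1P d2P d3P => _ _ _ + [_ _ _ +] [_ _ _ +] => x1 x2 x3.
by rewrite /comb !derE x1 x2 x3 diff_mulC -!scalerDl.
Qed.

Lemma derivation_decomp d : exists a b c R, d = comb a b c + ad R.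
Proof.
have EM p r : E (p * r) = E p * r + p * E r.
  by rewrite !diffE /euler !mderivM; ring.
have DM p r : D (p * r) = D p * r + p * D r by rewrite !diffE !mderivM; ring.
have [e dE] := potential_vector_field d EM.
have [g dD] := potential_vector_field d DM.
have [h [c eE]] := euler_decomp e.
pose R := potentialU d - mulU h.
(* Subtracting [ad] of the potential kills [d] on [S]; the term in [h] keeps this and, as [[h, E] =
   - euler h], reduces the value at [E] to the constant [c]. *)
pose d' := d - ad R.
have d'S p : d' (mulU p) = 0.
  rewrite /d' !derE /R; have := sub_ad_mulU d p; rewrite !derE => H.
  rewrite -[RHS]H; congr (_ - _).
  by rewrite mulrBl mulrBr -!diff_mulM [h * p]mulrC opprB addrA subrK.
have d'E : d' E = mulU c%:MP.
  apply: diffP => r; rewrite /d' !derE /R !diffE dE !diff_valE eE !diffE.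
  by rewrite /euler !mderivB !mderivM; ring.
have d'D : d' D = mulU (g - F * h^`M(1)).
  apply: diffP => r; rewrite /d' !derE /R !diffE dD !diff_valE !diffE.
  by rewrite mderivB mderivM; ring.
have /euler_linear gE : euler (g - F * h^`M(1)) = g - F * h^`M(1).
  by have := eulerE_rel d'E d'D; rewrite mderivC mulr0 subr0.
set g' := g - _ in gE d'D; set a' := g'@__ in gE; set b' := g'@__ in gE.
(* The coefficients solve the triangular system read off from [combD] and [combE]. *)
exists (c - b'), (a' / t), (b' - a' / t), R; apply/eqP; rewrite -subr_eq.
rewrite -/d' -subr_eq0; apply/eqP; apply: derivation_eq0.
- by rewrite derD derN combx subr0 d'S.
- by rewrite derD derN comby subr0 d'S.
- rewrite derD derN combD d'D gE mulfVK // [a' / t + _]addrC subrK.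
  by rewrite subrr.
- rewrite derD derN combE d'E -addrA [a' / t + _]addrC subrK subrK.
  by rewrite subrr.
Qed.

(** [R] commutes with [x] and [y], so it is multiplication by some [h]. The value at [E] makes
    [euler h] constant, hence zero, since its constant term vanishes; then [h] is constant and the
    value at [D] is zero too. *)
Lemma comb_inner a b c R : comb a b c = ad R -> [/\ a = 0, b = 0 & c = 0].
Proof.
move=> dR; have Rx : R = mulU (R 1).
  apply: diff_mulP; apply: ord2P.
    by have := combx a b c; rewrite dR.
  by have := comby a b c; rewrite dR.
set h := R 1 in Rx.
have hE : euler h = - (a + b + c)%:MP.
  have := combE a b c; rewrite dR adE Rx => /(congr1 (fun P : U => P 1)).
  rewrite !diffE /euler -mpolyC1 !mderivC mpolyC1 !mulr1 !mulr0 addr0 mulr0 sub0r.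
  by move=> <-; rewrite opprK.
have abc : a + b + c = 0.
  have := congr1 (mcoeff 0) hE; rewrite mcoeff_euler mdeg0 mul0r mcoeffN mcoeffC.
  by rewrite eqxx mulr1 => /esym/eqP; rewrite oppr_eq0 => /eqP.
have h0 : h^`M(1) = 0.
  by rewrite (euler_eq0 (p := h)) ?mderivC // hE abc mpolyC0 oppr0.
have := combD a b c; rewrite dR adE Rx => /(congr1 (fun P : U => P 1)).
rewrite !diffE -mpolyC1 mderivC mpolyC1 !mulr1 !mulr0 sub0r h0 mulr0 oppr0 => H.
have := congr1 (meval (pt 1 0)) H; have := congr1 (meval (pt 0 1)) H.
rewrite !mevalE !meval0 !mulr1 !mulr0 add0r addr0 => /esym bc /esym/eqP.
rewrite mulf_eq0 (negPf t_neq0) orbF => /eqP b0.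
by move: abc bc; rewrite b0 add0r addr0 => + c0; rewrite c0 addr0.
Qed.

Lemma out_class_ad R : out_class (ad R) = 0 :> outer_derivation U.
Proof.
rewrite -(linear0 (@out_class K U)); apply/out_classP.
by exists R; rewrite subr0.
Qed.

Definition comb_class (a b c : K) : outer_derivation U :=
  a *: out_class d1 + b *: out_class d2 + c *: out_class d3.

Lemma out_class_comb a b c : out_class (comb a b c) = comb_class a b c.
Proof. by rewrite /comb !linearD !linearZ. Qed.

Lemma comb_class_surj (v : outer_derivation U) : exists a b c, v = comb_class a b c.
Proof.
have [a [b [c [R dE]]]] := derivation_decomp (repr v).
exists a, b, c; rewrite -(out_class_repr v) dE linearD /= out_class_ad addr0.
exact: out_class_comb.
Qed.

Lemma comb_class_inj a b c a' b' c' :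
  comb_class a b c = comb_class a' b' c' -> [/\ a = a', b = b' & c = c'].
Proof.
rewrite -!out_class_comb => /out_classP[R dR].
have : comb (a - a') (b - b') (c - c') = ad R.
  rewrite -dR /comb !scalerBl !opprD !addrA.
  by rewrite [RHS](AC 6%N (1*4*2*5*3*6))/=.
by case/comb_inner => /eqP + /eqP + /eqP; rewrite !subr_eq0 => /eqP-> /eqP-> /eqP->.
Qed.

End Generators.

(** * Bracket, dimension and existence *)

Section Conclusion.
Variables d1 d2 d3 : derivation U.
Hypotheses (d1P : is_partial 'X_0 d1) (d2P : is_partial 'X_1 d2)
  (d3P : is_partial (t *: 'X_0 + 'X_1) d3).

Lemma outer_span_ind (P : outer_derivation U -> Prop) :
  P 0 -> (forall (a : K) u v, P u -> P v -> P (a *: u + v)) ->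
  P (out_class d1) -> P (out_class d2) -> P (out_class d3) -> forall v, P v.
Proof.
move=> P0 PL P1 P2 P3 v; have [a [b [c ->]]] := comb_class_surj d1P d2P d3P v.
rewrite /comb_class addrC; apply: (PL) => //; rewrite -[_ + _]addr0 -addrA.
by apply: (PL) => //; apply: PL.
Qed.

(** Each derivation sends the generators into [S], where the other vanishes, so the commutator is
    zero even before passing to classes. *)
Lemma lie_partial f g d e :
  is_partial f d -> is_partial g e -> lie d e = 0 :> derivation U.
Proof.
move=> [dx dy [a _ dD] dE] [ex ey [b _ eD] eE].
have lieE P : lie d e P = d (e P) - e (d P) by [].
apply: derivation_eq0; rewrite lieE.
- by rewrite dx ex (linear0 d) (linear0 e) subr0.
- by rewrite dy ey (linear0 d) (linear0 e) subr0.
- by rewrite dD eD (derivation_mul0 dx dy) (derivation_mul0 ex ey) subrr.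
- by rewrite dE eE !derivation1 subrr.
Qed.

Lemma outer_lie_abelian : lie_abelian (outer_derivation U).
Proof.
have lie0 f g d e : is_partial f d -> is_partial g e ->
    lie (out_class d) (out_class e) = 0 :> outer_derivation U.
  move=> dP eP; have -> : lie (out_class d) (out_class e) = out_class (lie d e).
    exact: out_lieE.
  by rewrite (lie_partial dP eP) linear0.
have lie0l (v : outer_derivation U) : lie 0 v = 0.
  by have := lieZl 0 0 v; rewrite !scale0r.
have lie0r (v : outer_derivation U) : lie v 0 = 0.
  by have := lieZr 0 v 0; rewrite !scale0r.
move=> u v; move: u; apply: outer_span_ind => [|a u u' Hu Hu'|||].
- exact: lie0l.
- by rewrite lieDl lieZl Hu Hu' scaler0 addr0.
all: move: v; apply: outer_span_ind => [|a v v' Hv Hv'|||];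
  by [exact: lie0r | rewrite lieDr lieZr Hv Hv' scaler0 addr0 | apply: lie0; eassumption].
Qed.

Lemma outer_dimension : has_dimension (outer_derivation U) 3.
Proof.
pose b (i : 'I_3) := out_class (nth d1 [:: d1; d2; d3] i).
have sumE (c : 'rV[K]_3) :
    \sum_(i < 3) c 0 i *: b i = comb_class d1 d2 d3 (c 0 0) (c 0 1) (c 0 (inord 2)).
  rewrite !big_ord_recl big_ord0 addr0 addrA /comb_class /b /=.
  by congr (_ *: _ + c 0 _ *: _ + c 0 _ *: _); apply: val_inj; rewrite /= ?inordK.
exists b => v; have [a1 [a2 [a3 ->]]] := comb_class_surj d1P d2P d3P v.
exists (\row_i nth 0 [:: a1; a2; a3] i); split=> [|c].
  by rewrite sumE !mxE inordK.
rewrite sumE => /(comb_class_inj d1P d2P d3P)[-> -> ->].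
apply/rowP => i; rewrite mxE; case: i => [[|[|[|m]]] // Hm] /=;
  by congr (c 0 _); apply: val_inj; rewrite /= ?inordK.
Qed.

End Conclusion.

Lemma exists_partials : exists d1 d2 d3 : derivation U,
  [/\ is_partial 'X_0 d1, is_partial 'X_1 d2 & is_partial (t *: 'X_0 + 'X_1) d3].
Proof.
have yQ : Q = 'X_1 * ('X_0 * (t *: 'X_0 + 'X_1)) by rewrite /arrQ /arrF mulrCA.
have lQ : Q = (t *: 'X_0 + 'X_1) * ('X_0 * 'X_1) by rewrite /arrQ /arrF; ring.
(* Each line is split off from [Q], with the product of the other two as cofactor. *)
exists (dlog (erefl Q) (@mprime_X0 K) (X0_ndvd (t := t))).
exists (dlog yQ (@mprime_X1 K) (X1_ndvd t_neq0)).
exists (dlog lQ (@mprime_ell K t) (ell_ndvd t_neq0)).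
split.
- apply: (is_partial_dlog _ _ _ (q := 0)).
    by rewrite /euler !mderivX1 /= mulr1 mulr0 addr0.
  by rewrite mderivX1 !mulr0.
- apply: (is_partial_dlog _ _ _ (q := t *: 'X_0 + 'X_1)).
    by rewrite /euler !mderivX1 /= mulr1 mulr0 add0r.
  by rewrite mderivX1 mulr1.
- apply: (is_partial_dlog _ _ _ (q := 'X_1)).
    rewrite /euler !mderivD !mderivZ !mderivX1 /= -!mul_mpolyC; ring.
  rewrite mderivD mderivZ !mderivX1 /= /arrF -!mul_mpolyC; ring.
Qed.

End Operators.

Theorem corollary5p10 (K : fieldType) (char0 : [pchar K] =i pred0)
    (t : K) (t_neq0 : t != 0) :
  (exists d1 d2 d3 : derivation (Diff t),
    [/\ is_partial 'X_0 d1, is_partial 'X_1 d2 &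
        is_partial (t *: 'X_0 + 'X_1) d3]) /\
  (forall d1 d2 d3 : derivation (Diff t),
    is_partial 'X_0 d1 -> is_partial 'X_1 d2 ->
    is_partial (t *: 'X_0 + 'X_1) d3 ->
    [/\ lie_abelian (outer_derivation (Diff t)),
        has_dimension (outer_derivation (Diff t)) 3 &
        lie_generated (fun u : outer_derivation (Diff t) =>
          [\/ u = out_class d1, u = out_class d2 | u = out_class d3])]).
Proof.
split=> [|d1 d2 d3 d1P d2P d3P]; first exact: exists_partials.
split.
- exact: outer_lie_abelian d1P d2P d3P.
- exact: outer_dimension d1P d2P d3P.
- move=> P P0 PL _ Pgen; apply: (outer_span_ind char0 t_neq0 d1P d2P d3P) => //.
  + by apply: Pgen; constructor 1.
  + by apply: Pgen; constructor 2.
  + by apply: Pgen; constructor 3.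
Qed.
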